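(* Let $\mathbb{F}$ be a field of characteristic distinct from $2$ and $3$, and let $L$ be a simple Lie algebra over $\mathbb{F}$. Suppose that $L$ contains an extremal element that is not a sandwich. Then either $\mathbb{F}$ has characteristic $5$ and $L$ is isomorphic to the $5$-dimensional Witt algebra $W_{1,1}(5)$ over $\mathbb{F}$, or $L$ is generated (as a Lie algebra) by extremal elements.
   Context: An element $x$ of a Lie algebra $L$ over $\mathbb{F}$ is called extremal if $[x,[x,L]]\subseteq \mathbb{F}x$, and is called a sandwich if $[x,[x,L]]=0$. For a field $\mathbb{F}$ of characteristic $5$, the Witt algebra $W_{1,1}(5)$ is the $5$-dimensional Lie algebra over $\mathbb{F}$ with basis $z^i\partial_z$, $i=0,\ldots,4$, and bracket given by bilinear extension of $[z^i\partial_z, z^j\partial_z]=(j-i)z^{i+j-1}\partial_z$, with the convention that $z^k:=0$ whenever $k\notin\{0,1,2,3,4\}$. *)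

(* Defs.v *)
From HB Require Import structures.
From mathcomp Require Import all_boot all_order all_algebra ring.

Set Implicit Arguments.
Unset Strict Implicit.
Unset Printing Implicit Defensive.

Import GRing.Theory.
Local Open Scope ring_scope.

(* The carrier may be of any dimension, finite or infinite. *)
HB.mixin Record Lmodule_isLieAlgebra (F : fieldType) L of GRing.Lmodule F L := {
  lie_bracket : L -> L -> L;
  lie_bracket_linearl : forall y : L, linear (lie_bracket^~ y);
  lie_bracket_linearr : forall x : L, linear (lie_bracket x);
  lie_bracketxx : forall x : L, lie_bracket x x = 0;
  lie_bracket_jacobi : forall x y z : L,
    lie_bracket x (lie_bracket y z) + lie_bracket y (lie_bracket z x)
      + lie_bracket z (lie_bracket x y) = 0
}.

#[short(type="lieAlgType")]
HB.structure Definition LieAlgebra (F : fieldType) :=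
  { L of GRing.Lmodule F L & Lmodule_isLieAlgebra F L }.

Notation "[< x , y >]" := (lie_bracket x y)
  (at level 0, x at level 99, y at level 99, format "[<  x ,  y  >]")
  : ring_scope.

Section LieTheory.
Variables (F : fieldType) (L : lieAlgType F).
Implicit Types (S : L -> Prop) (x : L).

Definition subspace S : Prop :=
  S 0 /\ forall (a : F) x y, S x -> S y -> S (a *: x + y).

Definition lie_subalgebra S : Prop :=
  subspace S /\ forall x y, S x -> S y -> S [< x, y >].

(* By antisymmetry of the bracket, one-sided ideals are two-sided. *)
Definition lie_ideal S : Prop :=
  subspace S /\ forall x y, S y -> S [< x, y >].

Definition lie_simple : Prop :=
  (exists x y : L, [< x, y >] <> 0) /\
  forall I : L -> Prop, lie_ideal I ->
    (forall x, I x -> x = 0) \/ (forall x, I x).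

Definition extremal x : Prop :=
  forall y : L, exists a : F, [< x, [< x, y >] >] = a *: x.

Definition sandwich x : Prop := forall y : L, [< x, [< x, y >] >] = 0.

Definition lie_span S x : Prop :=
  forall M : L -> Prop, lie_subalgebra M -> (forall y, S y -> M y) -> M x.

Definition lie_generated_by S : Prop := forall x, lie_span S x.

End LieTheory.

Definition lie_isomorphic (F : fieldType) (L M : lieAlgType F) : Prop :=
  exists f : {linear L -> M},
    bijective f /\ forall x y : L, f [< x, y >] = [< f x, f y >].

(* W_{1,1}(5): the i-th coordinate of a row vector is the coefficient of
   z^i d/dz. The Jacobi identity needs characteristic 5, hence the argument
   of the carrier type. *)
Definition witt5 (F : fieldType) (charF5 : 5%N \in [pchar F]) : Type :=
  'rV[F]_5.

Section Witt5.
Variable F : fieldType.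
Implicit Types u v w : 'rV[F]_5.

Definition witt_basis (k : int) : 'rV[F]_5 := \row_(l < 5) (l%:Z == k)%:R.

Definition witt_bracket u v : 'rV[F]_5 :=
  \sum_(i < 5) \sum_(j < 5)
    (u 0 i * v 0 j * (j%:R - i%:R)) *: witt_basis (i%:Z + j%:Z - 1).

Let wc u v (k : nat) : F :=
  let a i := u 0 (inord i) in let b i := v 0 (inord i) in
  match k with
  | 0 => a 0%N * b 1%N - a 1%N * b 0%N
  | 1 => 2 * (a 0%N * b 2 - a 2 * b 0%N)
  | 2 => 3 * (a 0%N * b 3 - a 3 * b 0%N) + (a 1%N * b 2 - a 2 * b 1%N)
  | 3 => 4 * (a 0%N * b 4 - a 4 * b 0%N) + 2 * (a 1%N * b 3 - a 3 * b 1%N)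
  | _ => 3 * (a 1%N * b 4 - a 4 * b 1%N) + (a 2 * b 3 - a 3 * b 2)
  end.

Let wcE u v (k : 'I_5) : witt_bracket u v 0 k = wc u v k.
Proof.
have sumE (G : 'I_5 -> F) : \sum_(i < 5) G i =
    G (inord 0) + (G (inord 1) + (G (inord 2) + (G (inord 3) + G (inord 4)))).
  rewrite !big_ord_recl big_ord0 addr0.
  by do !congr (_ + _); congr G; apply: val_inj; rewrite /= inordK.
rewrite /witt_bracket summxE sumE !summxE !sumE !mxE !inordK //.
by case: k => [[|[|[|[|[|k]]]]] hk] //=; rewrite /wc; ring.
Qed.

Lemma witt_bracket_linearl v : linear (witt_bracket^~ v).
Proof.
move=> a u w; apply/rowP=> k; rewrite !mxE !wcE.
by case: k => [[|[|[|[|[|k]]]]] hk] //=; rewrite /wc !mxE; ring.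
Qed.

Lemma witt_bracketxx u : witt_bracket u u = 0.
Proof.
apply/rowP=> k; rewrite wcE mxE.
by case: k => [[|[|[|[|[|k]]]]] hk] //=; rewrite /wc; ring.
Qed.

Lemma witt_bracket_linearr u : linear (witt_bracket u).
Proof.
move=> a v w; apply/rowP=> k; rewrite !mxE !wcE.
by case: k => [[|[|[|[|[|k]]]]] hk] //=; rewrite /wc !mxE; ring.
Qed.

Lemma witt_bracket_jacobi (charF5 : 5%N \in [pchar F]) u v w :
  witt_bracket u (witt_bracket v w) + witt_bracket v (witt_bracket w u)
    + witt_bracket w (witt_bracket u v) = 0.
Proof.
have F5 : 5%:R = 0 :> F := pcharf0 charF5.
apply/rowP=> k; rewrite !mxE !wcE.
case: k => [[|[|[|[|[|k]]]]] hk] //=; rewrite /wc !wcE !inordK //= /wc; try ring.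
set a := u 0; set b := v 0; set c := w 0.
rewrite -[RHS](mul0r (2 * (a (inord 0) * b (inord 4) * c (inord 2)
  - a (inord 0) * b (inord 2) * c (inord 4)
  + a (inord 2) * b (inord 0) * c (inord 4)
  - a (inord 2) * b (inord 4) * c (inord 0)
  + a (inord 4) * b (inord 2) * c (inord 0)
  - a (inord 4) * b (inord 0) * c (inord 2)))) -F5.
by ring.
Qed.

End Witt5.

HB.instance Definition _ (F : fieldType) (charF5 : 5%N \in [pchar F]) :=
  GRing.Lmodule.copy (witt5 charF5) 'rV[F]_5.

HB.instance Definition _ (F : fieldType) (charF5 : 5%N \in [pchar F]) :=
  Lmodule_isLieAlgebra.Build F (witt5 charF5)
    (@witt_bracket_linearl F) (@witt_bracket_linearr F)
    (@witt_bracketxx F) (witt_bracket_jacobi charF5).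

(* Main.v *)
From HB Require Import structures.
Require Import Defs.
From mathcomp Require Import all_boot all_algebra.
From mathcomp Require Import ring.
From Stdlib Require Import Classical.

Set Implicit Arguments.
Unset Strict Implicit.
Unset Printing Implicit Defensive.

(** Let [x] be extremal and not a sandwich. As in the Jacobson-Morozov theorem,
    [x] belongs to an sl2-triple ([x], [y], [h = [x, y]]), and since [ad x]
    has cube zero and square of rank one, [ad h] is diagonalisable with
    weights among -2, -1, 0, 1, 2; write [L_k] for the weight spaces. The
    extreme ones are the lines through [x] and [y] ([extremal_sl2],
    [sl2_decomp], [eigen2P], [eigenN2P]). Weights add up under the bracket, so
    this is a grading by integers with a single possible defect: the weight -3
    of [[y, L_{-1}]] is the weight of [x] when 5 = 0. The subalgebra generated
    by [x], [y], [L_1] and [L_{-1}] is normalised by [L_0], hence it is an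
    ideal, hence all of [L] ([generated_by_odd_part]).

    Suppose that [[y, L_{-1}] = 0]. Then [y] is extremal, and so is
    [e = exp (ad u) y] for every [u] in [L_1] ([extremal_exp_ad]); the
    component of [e] in [L_{-1}] is [[u, y]], so the subalgebra generated by
    the extremal elements contains [[x, [u, y]] = - u]. It therefore contains
    [L_1], then [L_{-1}], then [L]. For [e] to be extremal it is enough that
    [exp (ad u)] is onto and satisfies
    [exp (ad u) [y, z] = [e, exp (ad u) z]] for all [z] ([exp_ad_lie]). For
    [z = y] both sides are zero. For the other weight vectors [z], compare terms
    of equal degree in [u]: up to degree 4 this is the Leibniz rule, and the
    terms of higher degree vanish because [x] commutes with [L_1], except in
    degree 5 for [z] in [L_{-1}], where a bracket relation remains. It would
    follow from [(ad u)^5 = 0] after a division by 5. As this is impossible in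
    characteristic 5, the relation is derived from the formula
    [2 [p, [u, p]] = - 3 c u], where [p = [u, [u, y]]] and
    [[u, [u, p]] = c x] ([ad_p_u3], [exp_cocycle]).

    Suppose on the contrary that [[y, v] = x] for some [v] in [L_{-1}], after
    rescaling. Then 5 = 0, and the Jacobi identity for [y], [v] and any [v'] in
    [L_{-1}] forces [v'] to be proportional to [v] ([eigenN1_line]). So
    [L_{-1}] and [L_1] are lines, spanned by [v] and [w = [x, v]]; the element
    [[v, w]] is central, hence zero ([lie_vw]), and the multiplication table on
    [y], [h], [x], [v], [w] is that of the Witt algebra
    ([isomorphic_witt5]). *)

(** * Identities between linear combinations *)

Section LinComb.
Import GRing.Theory.
Local Open Scope ring_scope.
Variables (F : fieldType) (L : lmodType F).

(** Formal linear combinations of indexed vectors: an identity between vectors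
    is settled by comparing the scalar coefficients of each vector, which are
    left to ring and field tactics. *)
Inductive lin_expr :=
  | LinVar of nat | LinZero | LinAdd of lin_expr & lin_expr
  | LinOpp of lin_expr | LinScale of F & lin_expr.

Fixpoint lin_eval (env : seq L) (e : lin_expr) : L :=
  match e with
  | LinVar i => nth 0 env i
  | LinZero => 0
  | LinAdd e1 e2 => lin_eval env e1 + lin_eval env e2
  | LinOpp e1 => - lin_eval env e1
  | LinScale c e1 => c *: lin_eval env e1
  end.

Fixpoint lin_coef (e : lin_expr) (i : nat) : F :=
  match e with
  | LinVar j => if eqn j i then 1 else 0
  | LinZero => 0
  | LinAdd e1 e2 => lin_coef e1 i + lin_coef e2 i
  | LinOpp e1 => - lin_coef e1 i
  | LinScale c e1 => c * lin_coef e1 i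
  end.

Fixpoint lin_agree (e1 e2 : lin_expr) (n : nat) : Prop :=
  match n with
  | 0%N => True
  | n.+1 => lin_coef e1 n = lin_coef e2 n /\ lin_agree e1 e2 n
  end.

Lemma lin_evalE env e :
  lin_eval env e = \sum_(i < size env) lin_coef e i *: env`_i.
Proof.
elim: e => [j||e1 IH1 e2 IH2|e1 IH1|c e1 IH1] /=.
- have [ltj|lej] := ltnP j (size env); last first.
    rewrite nth_default // big1 // => i _.
    by rewrite eqnE gtn_eqF ?scale0r // (leq_trans (ltn_ord i)).
  rewrite (bigD1 (Ordinal ltj)) //= eqnE eqxx scale1r big1 ?addr0 // => i ni.
  by rewrite eq_sym (negPf ni : (i == j :> nat) = false) scale0r.
- by rewrite big1 // => i _; rewrite scale0r.
- by rewrite IH1 IH2 -big_split; apply: eq_bigr => i _; rewrite scalerDl.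
- by rewrite IH1 -sumrN; apply: eq_bigr => i _; rewrite scaleNr.
- by rewrite IH1 scaler_sumr; apply: eq_bigr => i _; rewrite scalerA.
Qed.

Lemma lin_eqP env e1 e2 :
  lin_agree e1 e2 (size env) -> lin_eval env e1 = lin_eval env e2.
Proof.
move=> agr; rewrite !lin_evalE; apply: eq_bigr => -[i /= lti] _.
elim: (size env) agr lti => //= n IH [eq_n agr].
by rewrite ltnS leq_eqVlt => /orP[/eqP->|/(IH agr)//]; rewrite eq_n.
Qed.

End LinComb.

Ltac lin_index t env :=
  lazymatch env with
  | t :: _ => constr:(0)
  | _ :: ?env' => let n := lin_index t env' in constr:(S n)
  end.

Ltac lin_mem t env :=
  lazymatch env with
  | nil => constr:(false)
  | t :: _ => constr:(true)
  | _ :: ?env' => lin_mem t env'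
  end.

Ltac lin_atoms t env :=
  lazymatch t with
  | GRing.zero => env
  | GRing.add ?a ?b => let env' := lin_atoms a env in lin_atoms b env'
  | GRing.opp ?a => lin_atoms a env
  | GRing.scale _ ?a => lin_atoms a env
  | _ => let b := lin_mem t env in
         lazymatch b with true => env | false => constr:(t :: env) end
  end.

Ltac lin_reify F t env :=
  lazymatch t with
  | GRing.zero => constr:(@LinZero F)
  | GRing.add ?a ?b =>
      let a' := lin_reify F a env in let b' := lin_reify F b env in
      constr:(LinAdd a' b')
  | GRing.opp ?a => let a' := lin_reify F a env in constr:(LinOpp a')
  | GRing.scale ?c ?a =>
      let a' := lin_reify F a env in constr:(@LinScale F c a')
  | _ => let n := lin_index t env in constr:(@LinVar F n)
  end.

Ltac lin_split tac :=
  lazymatch goal with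
  | |- True => exact I
  | |- _ /\ _ => split; [tac | lin_split tac]
  end.

(* [tac] has to settle the equality of the two coefficients of a vector. *)
Ltac lincomb_with F L tac :=
  lazymatch goal with
  | |- @eq _ ?a ?b =>
      let env0 := constr:(@nil L) in
      let env1 := lin_atoms a env0 in
      let env := lin_atoms b env1 in
      let ea := lin_reify F a env in
      let eb := lin_reify F b env in
      change (@lin_eval F L env ea = @lin_eval F L env eb);
      apply: lin_eqP; cbn [lin_agree size lin_coef eqn];
      lin_split tac
  end.

(** * Brackets and eigenvectors of inner derivations *)

Section LieBasics.
Import GRing.Theory.
Local Open Scope ring_scope.
Variables (F : fieldType) (L : lieAlgType F).
Implicit Types (a b k : F) (u v w x y z h : L).

Lemma lieDl u v z : [< u + v, z >] = [< u, z >] + [< v, z >].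
Proof. by have := lie_bracket_linearl z 1 u v; rewrite !scale1r. Qed.

Lemma lieDr z u v : [< z, u + v >] = [< z, u >] + [< z, v >].
Proof. by have := lie_bracket_linearr z 1 u v; rewrite !scale1r. Qed.

Lemma lie0l z : [< 0, z >] = 0.
Proof. by apply: (addrI [< 0, z >]); rewrite -lieDl !addr0. Qed.

Lemma lie0r z : [< z, 0 >] = 0.
Proof. by apply: (addrI [< z, 0 >]); rewrite -lieDr !addr0. Qed.

Lemma lieZl a u z : [< a *: u, z >] = a *: [< u, z >].
Proof. by have := lie_bracket_linearl z a u 0; rewrite lie0l !addr0. Qed.

Lemma lieZr z a u : [< z, a *: u >] = a *: [< z, u >].
Proof. by have := lie_bracket_linearr z a u 0; rewrite lie0r !addr0. Qed.

Lemma lieNl u z : [< - u, z >] = - [< u, z >].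
Proof. by rewrite -scaleN1r lieZl scaleN1r. Qed.

Lemma lieNr z u : [< z, - u >] = - [< z, u >].
Proof. by rewrite -scaleN1r lieZr scaleN1r. Qed.

Definition lieE := (lieDl, lieDr, lieZl, lieZr, lieNl, lieNr, lie0l, lie0r).

Lemma lieC u v : [< u, v >] = - [< v, u >].
Proof.
apply/eqP; rewrite -addr_eq0; apply/eqP.
by have := lie_bracketxx (u + v); rewrite !lieE !lie_bracketxx add0r addr0.
Qed.

Lemma lie_leibniz u v w :
  [< u, [< v, w >] >] = [< [< u, v >], w >] + [< v, [< u, w >] >].
Proof.
apply/eqP; rewrite -subr_eq0; apply/eqP.
by rewrite -[RHS](lie_bracket_jacobi u v w) (lieC w [< u, v >]) (lieC w u)
  lieNr opprD [- _ - _]addrC addrA.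
Qed.

Lemma lie_leibnizl u v w :
  [< [< u, v >], w >] = [< u, [< v, w >] >] - [< v, [< u, w >] >].
Proof. by rewrite lie_leibniz addrK. Qed.

(** Elements of weight [k] for [h], zero included. *)
Definition eigen h k v := [< h, v >] = k *: v.

Lemma eigenZ h k a v : eigen h k v -> eigen h k (a *: v).
Proof. by rewrite /eigen lieZr => ->; rewrite !scalerA mulrC. Qed.

(** The target weight is a separate variable because it is most often equal
    to the sum by a computation in the field, possibly modulo 5. *)
Lemma eigen_lie h (i j k : F) u v : i + j = k ->
  eigen h i u -> eigen h j v -> eigen h k [< u, v >].
Proof.
by move=> <- hu hv; rewrite /eigen lie_leibniz hu hv lieZl lieZr scalerDl.
Qed.

Lemma lie_sum (I : Type) (s : seq I) (f : I -> L) h :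
  [< h, \sum_(i <- s) f i >] = \sum_(i <- s) [< h, f i >].
Proof.
elim: s => [|i s IH]; first by rewrite !big_nil lie0r.
by rewrite !big_cons lieDr IH.
Qed.

(** Eigenvectors for distinct eigenvalues are independent. They are given as a
    family so that the induction hypothesis applies to a rescaled one. *)
Lemma eigen_sum_eq0 h (I : eqType) (lam : I -> F) (s : seq I) (f : I -> L) :
  uniq (map lam s) -> (forall i, eigen h (lam i) (f i)) ->
  \sum_(i <- s) f i = 0 -> forall i, i \in s -> f i = 0.
Proof.
elim: s f => [//|i0 s IH] f /= /andP[i0s us] hf sum0 i.
have tail0 j : j \in s -> f j = 0.
  move=> js; have nz : lam j - lam i0 != 0.
    by rewrite subr_eq0; apply: contraNneq i0s => <-; apply: map_f.
  apply: (scalerI nz); rewrite scaler0.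
  apply: (IH (fun j => (lam j - lam i0) *: f j)) => //.
    by move=> k; apply: eigenZ.
  have := congr1 (fun z => [< h, z >] - lam i0 *: z) sum0.
  rewrite lie_sum !big_cons hf lie0r scaler0 subr0 scalerDr opprD addrACA subrr.
  rewrite add0r scaler_sumr -sumrB => eq0; rewrite -[RHS]eq0.
  apply: eq_bigr => k _.
  by rewrite hf scalerBl.
rewrite inE => /orP[/eqP ->|]; last exact: tail0.
by rewrite big_cons big_seq big1 ?addr0 in sum0.
Qed.

(** An eigenvector equals its own weight component: apply [ad h - k] and use
    independence. *)
Lemma eigen_sum_component h (I : eqType) (lam : I -> F) (s : seq I)
    (f : I -> L) k :
  uniq (map lam s) -> (forall i, eigen h (lam i) (f i)) ->
  eigen h k (\sum_(i <- s) f i) ->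
  forall i, i \in s -> lam i != k -> f i = 0.
Proof.
move=> us hf hk i is_ nek.
have nz : lam i - k != 0 by rewrite subr_eq0.
apply: (scalerI nz); rewrite scaler0.
apply: (eigen_sum_eq0 (f := fun i => (lam i - k) *: f i) us) => //.
  by move=> j; apply: eigenZ.
rewrite -[RHS](subrr (k *: \sum_(i <- s) f i)) -{1}hk lie_sum scaler_sumr.
by rewrite -sumrB; apply: eq_bigr => j _; rewrite hf scalerBl.
Qed.

End LieBasics.

(** * Generated subalgebras and simplicity *)

Section SpanClosure.
Import GRing.Theory.
Local Open Scope ring_scope.
Variables (F : fieldType) (L : lieAlgType F).
Implicit Types (S : L -> Prop) (a : F) (x y z c : L).

Lemma subspaceD S x y : subspace S -> S x -> S y -> S (x + y).
Proof. by move=> [_ SD] Sx Sy; rewrite -[x]scale1r; apply: SD. Qed.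

Lemma subspaceZ S a x : subspace S -> S x -> S (a *: x).
Proof. by move=> [S0 SD] Sx; rewrite -[_ *: x]addr0; apply: SD. Qed.

Lemma lie_span_subalgebra S : lie_subalgebra (lie_span S).
Proof.
split; [split|].
- by move=> M [[]].
- move=> a x y Sx Sy M subM SM; have [[_ MD] _] := subM.
  by apply: MD; [exact: Sx | exact: Sy].
move=> x y Sx Sy M subM SM; have [_ Ml] := subM.
by apply: Ml; [exact: Sx | exact: Sy].
Qed.

Lemma lie_span_gen S x : S x -> lie_span S x.
Proof. by move=> Sx M _; apply. Qed.

(** It is enough to test the ideal property on generators: by the Jacobi
    identity, the elements that every [ad z] maps into the span form a
    subalgebra. *)
Lemma lie_span_ideal S :
  (forall z t, S t -> lie_span S [< z, t >]) -> lie_ideal (lie_span S).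
Proof.
move=> Sad; have [spanS Sl] := lie_span_subalgebra S; have [S0 SD] := spanS.
split=> // z t St.
suff [] : lie_span S t /\ forall z, lie_span S [< z, t >] by [].
apply: (St (fun t => lie_span S t /\ forall z, lie_span S [< z, t >])).
  split; [split|].
  - by split=> // z'; rewrite lie0r.
  - move=> a x y [Sx xl] [Sy yl]; split; first exact: SD.
    by move=> z'; rewrite lieDr lieZr; apply: SD.
  move=> x y [Sx xl] [Sy yl]; split; first exact: Sl.
  by move=> z'; rewrite lie_leibniz; apply: (subspaceD spanS); apply: Sl.
by move=> y Sy; split; [apply: lie_span_gen | move=> z'; apply: Sad].
Qed.

Lemma centralizer_subalgebra c : lie_subalgebra (fun z => [< c, z >] = 0).
Proof.
split; [split|]; first by rewrite lie0r.
  by move=> a x y cx cy; rewrite !lieE cx cy scaler0 addr0.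
by move=> x y cx cy; rewrite lie_leibniz cx cy !lieE addr0.
Qed.

(** The center is an ideal, and it is not everything. *)
Lemma simple_center_eq0 c :
  lie_simple L -> (forall z, [< c, z >] = 0) -> c = 0.
Proof.
move=> [[x [y nab]] simL] cz.
case: (simL (fun c => forall z, [< c, z >] = 0)).
- split; [split|].
  + by move=> z; rewrite lie0l.
  + by move=> a u v uz vz z; rewrite !lieE uz vz scaler0 addr0.
  by move=> u v vz z; rewrite (lieC u) vz oppr0 lie0l.
- by apply.
by move=> /(_ x y).
Qed.

End SpanClosure.

Section Isomorphism.
Import GRing.Theory.
Local Open Scope ring_scope.

Lemma lie_isomorphic_from_inverse (F : fieldType) (L M : lieAlgType F)
    (g : {linear M -> L}) :
  injective g -> (forall z, exists r, g r = z) ->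
  (forall r s, g [< r, s >] = [< g r, g s >]) -> lie_isomorphic L M.
Proof.
move=> g_inj g_surj g_lie.
have g_surjb z : exists r, g r == z by have [r <-] := g_surj z; exists r.
pose f z := xchoose (g_surjb z).
have fK : cancel f g by move=> z; apply/eqP/(xchooseP (g_surjb z)).
have gK : cancel g f by move=> r; apply: g_inj; rewrite fK.
have f_lin : linear f by move=> a u v; apply: g_inj; rewrite linearP !fK.
pose fL : {linear L -> M} := HB.pack f (GRing.isLinear.Build F L M _ f f_lin).
exists fL; split; first by exists g.
by move=> u v; apply: g_inj; rewrite g_lie /= !fK.
Qed.

End Isomorphism.

(** * The sl2-triple of an extremal element *)

Section Triple.
Import GRing.Theory.
Local Open Scope ring_scope.
Variables (F : fieldType) (L : lieAlgType F).
Hypotheses (nz2 : 2 != 0 :> F) (nz3 : 3 != 0 :> F).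
Implicit Types (a b c k : F) (u v w x y z h : L).

Let nz4 : 4 != 0 :> F.
Proof. by rewrite (_ : 4 = 2 * 2) ?mulf_neq0 //; ring. Qed.

Ltac scalar_eq := first [ring | by field; rewrite ?nz2 ?nz3 ?nz4].
Ltac lincomb := lincomb_with F L ltac:(scalar_eq).

(** The case needed here of the commutation rule of [(ad x)^2] with [ad y];
    the last component [y] of the triple need not be a weight vector. *)
Lemma adx2_ady x y u :
  [< [< x, y >], x >] = 2 *: x -> [< x, [< x, u >] >] = 0 ->
  [< x, [< x, [< y, u >] >] >]
    = 2 *: ([< [< x, y >], [< x, u >] >] - [< x, u >]).
Proof.
set h := [< x, y >] => hx xxu.
have xh : [< x, h >] = - (2 *: x) by rewrite lieC hx.
rewrite (lie_leibniz x y) -/h lieDr (lie_leibniz x h) xh.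
rewrite (lie_leibniz x y) -/h xxu !lieE.
by lincomb.
Qed.

(** On the kernel of [ad x] the operator [H = ad h] satisfies
    [H (H - 1) (H - 2) = 0], because [H z = [x, [y, z]]] and
    [(H - 1) H z = [x, [x, [y, [y, z]]]] / 2] is a multiple of [x], which has
    weight 2. Only [[h, x] = 2 x] is assumed, so that the lemma applies before
    [y] has been adjusted to have weight -2. *)
Lemma ker_decomp x y z :
  extremal x -> [< [< x, y >], x >] = 2 *: x -> [< x, z >] = 0 ->
  exists z0 z1 b, [/\ z = z0 + z1 + b *: x,
    eigen [< x, y >] 0 z0, eigen [< x, y >] 1 z1,
    [< x, z0 >] = 0 & [< x, z1 >] = 0].
Proof.
move=> extx hx xz; set h := [< x, y >] in hx *.
have hz : [< h, z >] = [< x, [< y, z >] >].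
  by rewrite (lie_leibniz x) xz lie0r addr0.
have xhz : [< x, [< h, z >] >] = 0.
  by rewrite lie_leibniz xz lie0r addr0 (lieC x) hx !lieE xz scaler0 oppr0.
have [c cE] := extx [< y, [< y, z >] >].
rewrite adx2_ady // -?hz // in cE.
have hhz : [< h, [< h, z >] >] = [< h, z >] + (c / 2) *: x.
  by rewrite -[LHS](subrK [< h, z >]) addrC; congr (_ + _);
    apply: (scalerI nz2); rewrite cE; lincomb.
exists (z - [< h, z >] + (c / 4) *: x), ([< h, z >] - (c / 2) *: x), (c / 4).
rewrite /eigen !lieE hhz hx xz xhz lie_bracketxx; split; by lincomb.
Qed.

(** Some [y1] satisfies all but [[h, y1] = - 2 y1]. The defect
    [[h, y1] + 2 y1] commutes with [x], and [ad h + 2] is invertible on the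
    kernel of [ad x], where its eigenvalues are 2, 3 and 4. *)
Lemma extremal_sl2 x : extremal x -> ~ sandwich x ->
  exists y, [< [< x, y >], x >] = 2 *: x /\ [< [< x, y >], y >] = - 2 *: y.
Proof.
move=> extx nsand.
have [y0 /eqP y0nz] : exists y, [< x, [< x, y >] >] <> 0.
  by apply: not_all_ex_not.
have [c cE] := extx y0.
have nzc : c != 0 by apply: contraNneq y0nz => c0; rewrite cE c0 scale0r.
have [y1 xh] : exists y1, [< x, [< x, y1 >] >] = - 2 *: x.
  by exists ((- 2 / c) *: y0); rewrite !lieE cE scalerA divfK.
set h := [< x, y1 >] in xh.
have hx : [< h, x >] = 2 *: x by rewrite lieC xh scaleNr opprK.
have xw : [< x, [< h, y1 >] + 2 *: y1 >] = 0.
  rewrite lieDr lieZr (lie_leibniz x h) xh -/h lieZl -/h lie_bracketxx.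
  by lincomb.
have [w0 [w1 [b [wE hw0 hw1 xw0 xw1]]]] := ker_decomp extx hx xw.
rewrite -/h in hw0 hw1.
(* The preimage of the defect under [ad h + 2]. *)
pose u := 2^-1 *: w0 + 3^-1 *: w1 + (b / 4) *: x.
exists (y1 - u).
have -> : [< x, y1 - u >] = h.
  by rewrite /u !lieE xw0 xw1 lie_bracketxx -/h; lincomb.
split=> //; rewrite lieDr (_ : [< h, y1 >] = w0 + w1 + b *: x - 2 *: y1).
  by rewrite /u !lieE hw0 hw1 hx; lincomb.
by rewrite -wE addrK.
Qed.

(** Subtracting a multiple of [y] brings [z] into the kernel of [(ad x)^2],
    then a multiple of [h] and an element of [[y, L_1]] bring it into the kernel
    of [ad x], where [ker_decomp] applies. *)
Lemma sl2_decomp x y z :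
  extremal x ->
  [< [< x, y >], x >] = 2 *: x -> [< [< x, y >], y >] = - 2 *: y ->
  exists a v d w b, [/\ z = a *: y + v + d + w + b *: x,
    eigen [< x, y >] (- 1) v, eigen [< x, y >] 0 d, eigen [< x, y >] 1 w
    & [< x, w >] = 0].
Proof.
set h := [< x, y >] => extx hx hy.
have xh : [< x, h >] = - (2 *: x) by rewrite lieC hx.
have [c cE] := extx z.
(* [z1] and [a1] are opaque: bilinearity must not be applied inside them. *)
have [z1 z1E] : exists z1, z1 = z + (c / 2) *: y by exists (z + (c / 2) *: y).
have xxz1 : [< x, [< x, z1 >] >] = 0.
  by rewrite z1E !lieE cE -/h xh; lincomb.
have [b bE] := extx [< y, z1 >].
rewrite adx2_ady // -/h in bE.
have hxz1 : [< h, [< x, z1 >] >] = [< x, z1 >] + (b / 2) *: x.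
  by rewrite -[LHS](subrK [< x, z1 >]) addrC; congr (_ + _);
    apply: (scalerI nz2); rewrite bE; lincomb.
have [a1 a1E] : exists a1 : L, a1 = [< x, z1 >] - (b / 2) *: x.
  by exists ([< x, z1 >] - (b / 2) *: x).
have ha1 : [< h, a1 >] = a1 by rewrite a1E !lieE hxz1 hx; lincomb.
have xa1 : [< x, a1 >] = 0 by rewrite a1E !lieE xxz1 lie_bracketxx; lincomb.
have hya1 : [< h, [< y, a1 >] >] = - [< y, a1 >].
  by rewrite lie_leibniz ha1 hy !lieE; lincomb.
have xya1 : [< x, [< y, a1 >] >] = a1.
  by rewrite lie_leibniz xa1 -/h ha1 lie0r addr0.
have xz2 : [< x, z1 + (b / 4) *: h - [< y, a1 >] >] = 0.
  by rewrite !lieE xya1 xh a1E; lincomb.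
have [z20 [z21 [g [z2E hz20 hz21 xz20 xz21]]]] := ker_decomp extx hx xz2.
exists (- (c / 2)), [< y, a1 >], (z20 - (b / 4) *: h), z21, g; split => //.
- have -> : z = (z1 + (b / 4) *: h - [< y, a1 >]) + [< y, a1 >]
     - (b / 4) *: h - (c / 2) *: y by rewrite z1E; lincomb.
  by rewrite z2E; lincomb.
- by rewrite /eigen hya1 scaleN1r.
- by rewrite /eigen !lieE hz20 lie_bracketxx; lincomb.
Qed.

(** * The weight decomposition *)

Section Graded.
Variables x y : L.
Notation h := [< x, y >].
Hypotheses (extx : extremal x) (hx : [< h, x >] = 2 *: x)
  (hy : [< h, y >] = - 2 *: y).

(* Two distinct weights differ by at most 4 in absolute value, and 1, 2, 3 and 4
   are invertible. *)
Ltac weights_differ := rewrite -subr_eq0; first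
  [ by rewrite (_ : _ - _ = 1) ?oner_neq0 //; ring
  | by rewrite (_ : _ - _ = - 1) ?oppr_eq0 ?oner_neq0 //; ring
  | by rewrite (_ : _ - _ = 2) //; ring
  | by rewrite (_ : _ - _ = - 2) ?oppr_eq0 //; ring
  | by rewrite (_ : _ - _ = 3) //; ring
  | by rewrite (_ : _ - _ = - 3) ?oppr_eq0 //; ring
  | by rewrite (_ : _ - _ = 4) //; ring
  | by rewrite (_ : _ - _ = - 4) ?oppr_eq0 //; ring ].

Lemma eigen_decomp k z : eigen h k z ->
  exists a v d w b, [/\ z = a *: y + v + d + w + b *: x,
    eigen h (- 1) v, eigen h 0 d, eigen h 1 w & [< x, w >] = 0] /\
    [/\ - 2 != k -> a *: y = 0, - 1 != k -> v = 0, 0 != k -> d = 0,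
        1 != k -> w = 0 & 2 != k -> b *: x = 0].
Proof.
move=> hz; have [a [v [d [w [b [zE hv hd hw xw]]]]]] :=
  sl2_decomp z extx hx hy.
exists a, v, d, w, b; split=> //.
pose lam (i : nat) : F := i%:R - 2.
pose f (i : nat) := nth 0 [:: a *: y; v; d; w; b *: x] i.
have ul : uniq (map lam (iota 0 5)).
  rewrite /= !inE !negb_or /lam; do ?[apply/andP; split=> //]; weights_differ.
have hf i : eigen h (lam i) (f i).
  case: i => [|[|[|[|[|i]]]]]; rewrite /f /lam /=.
  - by rewrite (_ : _ - _ = - 2); [apply: eigenZ | ring].
  - by rewrite (_ : _ - _ = - 1) //; ring.
  - by rewrite (_ : _ - _ = 0) //; ring.
  - by rewrite (_ : _ - _ = 1) //; ring.
  - by rewrite (_ : _ - _ = 2); [apply: eigenZ | ring].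
  by rewrite nth_nil /eigen lie0r scaler0.
have sumE : \sum_(i <- iota 0 5) f i = z.
  by rewrite /= !big_cons big_nil /f /= zE; lincomb.
have fz i : i \in iota 0 5 -> lam i != k -> f i = 0.
  by apply: (eigen_sum_component ul hf); rewrite sumE.
split=> nek; [apply: (fz 0%N) | apply: (fz 1%N) | apply: (fz 2%N)
  | apply: (fz 3%N) | apply: (fz 4%N)] => //; rewrite /lam.
- by rewrite (_ : _ - _ = - 2) //; ring.
- by rewrite (_ : _ - _ = - 1) //; ring.
- by rewrite (_ : _ - _ = 0) //; ring.
- by rewrite (_ : _ - _ = 1) //; ring.
by rewrite (_ : _ - _ = 2) //; ring.
Qed.

Lemma eigen2P z : eigen h 2 z -> exists b, z = b *: x.
Proof.
move=> /eigen_decomp[a [v [d [w [b [[-> _ _ _ _] [ya v0 d0 w0 _]]]]]]].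
by exists b; rewrite ya ?v0 ?d0 ?w0; [lincomb | weights_differ..].
Qed.

Lemma eigenN2P z : eigen h (- 2) z -> exists a, z = a *: y.
Proof.
move=> /eigen_decomp[a [v [d [w [b [[-> _ _ _ _] [_ v0 d0 w0 xb]]]]]]].
by exists a; rewrite xb ?v0 ?d0 ?w0; [lincomb | weights_differ..].
Qed.

Lemma adx_eigen1 z : eigen h 1 z -> [< x, z >] = 0.
Proof.
move=> /eigen_decomp[a [v [d [w [b [[-> _ _ _ xw] [ya v0 d0 _ xb]]]]]]].
by rewrite ya ?v0 ?d0 ?xb ?addr0 ?add0r //; weights_differ.
Qed.

(** -3 differs from all five weights unless 5 = 0. *)
Lemma eigenN3_eq0 z : 5 != 0 :> F -> eigen h (- 3) z -> z = 0.
Proof.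
move=> nz5 /eigen_decomp[a [v [d [w [b [[-> _ _ _ xw] [ya v0 d0 w0 xb]]]]]]].
rewrite ya ?v0 ?d0 ?w0 ?xb ?addr0 //; try weights_differ.
by rewrite -subr_eq0 (_ : _ - _ = 5) //; ring.
Qed.

Lemma adx_eigenN1 v : eigen h (- 1) v -> eigen h 1 [< x, v >].
Proof. by apply: (eigen_lie (i := 2) (j := - 1)) => //; ring. Qed.

Lemma ady_eigen1 w : eigen h 1 w -> eigen h (- 1) [< y, w >].
Proof. by apply: (eigen_lie (i := - 2) (j := 1)) => //; ring. Qed.

Lemma adx_ady_eigen1 w : eigen h 1 w -> [< x, [< y, w >] >] = w.
Proof.
move=> hw; rewrite lie_leibniz (adx_eigen1 hw) lie0r addr0.
by rewrite hw scale1r.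
Qed.

Lemma ady_adx_eigenN1 v : eigen h (- 1) v -> [< x, [< y, v >] >] = 0 ->
  [< y, [< x, v >] >] = v.
Proof.
move=> hv xyv; rewrite lie_leibniz xyv addr0 (lieC y) lieNl hv.
by rewrite scaleN1r opprK.
Qed.

(** The subalgebra in question is stable under [ad] of each weight component of
    an element: [L_0] preserves the generating set up to scalars, and the other
    components lie in the subalgebra. So it is a nonzero ideal. *)
Lemma generated_by_odd_part M : lie_simple L -> x <> 0 ->
  lie_subalgebra M -> M x -> M y ->
  (forall w, eigen h 1 w -> M w) -> (forall v, eigen h (- 1) v -> M v) ->
  forall z, M z.
Proof.
move=> [_ simL] xnz subM Mx My M1 MN1 z.
pose T t := [\/ t = x, t = y, eigen h 1 t | eigen h (- 1) t].
suff Tall : forall z, lie_span T z.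
  by apply: Tall => // t [->|->|/M1|/MN1].
have [spanT Tl] := lie_span_subalgebra T.
have Tx : lie_span T x by apply: lie_span_gen; apply: Or41.
have Ty : lie_span T y by apply: lie_span_gen; apply: Or42.
have T1 w : eigen h 1 w -> lie_span T w.
  by move=> hw; apply: lie_span_gen; apply: Or43.
have TN1 v : eigen h (- 1) v -> lie_span T v.
  by move=> hv; apply: lie_span_gen; apply: Or44.
have TZ a t : lie_span T t -> lie_span T (a *: t) by apply: subspaceZ.
have ideT : lie_ideal (lie_span T).
  apply: lie_span_ideal => {}z t Tt.
  have [a [v [d [w [b [-> hv hd hw _]]]]]] :=
    sl2_decomp z extx hx hy.
  have St : lie_span T t by apply: lie_span_gen.
  have Tdt : lie_span T [< d, t >].
    case: Tt => [->|->|ht|ht].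
    - have [|c ->] := @eigen2P [< d, x >]; last exact: TZ.
      by apply: (eigen_lie (i := 0) (j := 2)) => //; ring.
    - have [|c ->] := @eigenN2P [< d, y >]; last exact: TZ.
      by apply: (eigen_lie (i := 0) (j := - 2)) => //; ring.
    - by apply: T1; apply: (eigen_lie _ hd ht) => //; ring.
    by apply: TN1; apply: (eigen_lie _ hd ht) => //; ring.
  rewrite !lieDl; do !apply: (subspaceD spanT); rewrite ?lieZl //.
  - by apply: TZ; apply: Tl.
  - by apply: Tl => //; apply: TN1.
  - by apply: Tl => //; apply: T1.
  by apply: TZ; apply: Tl.
by have [/(_ x Tx)|] := simL _ ideT.
Qed.

(** * Extremal elements generate when y and L_{-1} commute *)

Section ExtremalGeneration.
Hypothesis yN1 : forall v, eigen h (- 1) v -> [< y, v >] = 0.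

Let xh : [< x, h >] = - 2 *: x.
Proof. by rewrite lieC hx scaleNr. Qed.

Let yh : [< y, h >] = 2 *: y.
Proof. by rewrite lieC hy scaleNr opprK. Qed.

Let yx : [< y, x >] = - h.
Proof. exact: lieC. Qed.

Lemma extremal_opposite : extremal y.
Proof.
move=> z; have [a [v [d [w [b [-> hv hd hw xw]]]]]] :=
  sl2_decomp z extx hx hy.
have [c yd] : exists c, [< y, d >] = c *: y.
  by apply: eigenN2P; apply: (eigen_lie _ hy hd); ring.
have yyw : [< y, [< y, w >] >] = 0.
  by apply: yN1; apply: (ady_eigen1 hw).
exists (b * (- 2)); rewrite !lieE yx (yN1 hv) yd yyw !(lieE, lie_bracketxx) yh.
by lincomb.
Qed.

Section Exponential.
Variable u : L.
Hypothesis hu : eigen h 1 u.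

(* These have weights -1, 0 and 1. *)
Let q := [< u, y >].
Let p := [< u, q >].
Let u3 := [< u, p >].

Let uh : [< u, h >] = - u.
Proof. by rewrite lieC hu scale1r. Qed.

Let ux : [< u, x >] = 0.
Proof. by rewrite lieC adx_eigen1 ?oppr0. Qed.

Let hq : eigen h (- 1) q.
Proof. by apply: (eigen_lie _ hu hy); ring. Qed.

Let hp : eigen h 0 p.
Proof. by apply: (eigen_lie _ hu hq); ring. Qed.

Let hu3 : eigen h 1 u3.
Proof. by apply: (eigen_lie _ hu hp); ring. Qed.

Let yq : [< y, q >] = 0.
Proof. exact: yN1. Qed.

Let xq : [< x, q >] = - u.
Proof. by rewrite /q lie_leibniz (adx_eigen1 hu) lie0l add0r uh. Qed.

Let xp : [< x, p >] = 0.
Proof.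
rewrite /p lie_leibniz (adx_eigen1 hu) lie0l add0r xq lieNr.
by rewrite lie_bracketxx oppr0.
Qed.

Let yp : [< y, p >] = 0.
Proof.
by rewrite /p lie_leibniz yq lie0r addr0 (lieC y) lieNl lie_bracketxx oppr0.
Qed.

Let uu3_line : exists c, [< u, u3 >] = c *: x.
Proof. by apply: eigen2P; apply: (eigen_lie _ hu hu3); ring. Qed.

(** Two expressions for [[u3, q]] follow from [[p, p] = 0] and from
    [q = [u, y]]; their sum gives [2 [u3, q] = - c h], and [p = [u, q]] then
    gives the claim. *)
Lemma ad_p_u3 c : [< u, u3 >] = c *: x -> [< p, u3 >] = - (3 / 2 * c) *: u.
Proof.
move=> uu3.
have u3q_h : [< u3, q >] = - c *: h + [< u, [< u3, y >] >].
  by rewrite /q lie_leibniz (lieC u3 u) uu3 !lieE scaleNr.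
have u3q_p : [< u3, q >] = - [< u, [< u3, y >] >].
  have pq : [< p, q >] = - [< u3, y >].
    by rewrite /q lie_leibniz (lieC p u) -/u3 (lieC p y) yp oppr0 lie0r addr0
      lieNl.
  have := lie_bracketxx p; rewrite {2}/p lie_leibniz (lieC p u) -/u3 pq.
  by rewrite lieNl lieNr -opprD => /eqP; rewrite oppr_eq0 addr_eq0 => /eqP.
have u3q : [< u3, q >] = - (c / 2) *: h.
  apply: (scalerI nz2).
  rewrite (_ : 2 *: _ = [< u3, q >] + [< u3, q >]); last by lincomb.
  by rewrite {1}u3q_h u3q_p; lincomb.
rewrite {1}/p lie_leibnizl (lieC q u3) u3q uu3 (lieC q) !lieE xq uh.
by lincomb.
Qed.

(** Write [v = [y, w]] with [w = [x, v]] and expand [(ad u)^2 [y, w]]. *)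
Lemma adu2_eigenN1 v c : eigen h (- 1) v -> [< u, [< x, v >] >] = c *: x ->
  [< u, [< u, v >] >] = [< p, [< x, v >] >] + (2 * c) *: u.
Proof.
move=> hv uw.
have vE : [< y, [< x, v >] >] = v.
  by apply: (ady_adx_eigenN1 hv); rewrite yN1 // lie0r.
rewrite -{1}vE (lie_leibniz u y) -/q uw.
rewrite !lieE (lie_leibniz u q) -/p uw !lieE (lie_leibniz u y) -/q ux lie0r.
rewrite addr0 (lieC q) xq.
by lincomb.
Qed.

(** The degree 5 part of [[exp (ad u) y, exp (ad u) v] = 0], up to the factor
    24. There is no term in [[p, (ad u)^3 v]] because [p] commutes with [x]. *)
Lemma exp_cocycle v c : eigen h (- 1) v -> [< u, u3 >] = c *: x ->
  c *: [< x, [< u, v >] >] + 2 *: [< u3, [< u, [< u, v >] >] >] = 0.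
Proof.
move=> hv uu3; set w := [< x, v >].
have hw : eigen h 1 w by apply: adx_eigenN1.
have [o uw] : exists o, [< u, w >] = o *: x.
  by apply: eigen2P; apply: (eigen_lie _ hu hw); ring.
have [o3 u3w] : exists o, [< u3, w >] = o *: x.
  by apply: eigen2P; apply: (eigen_lie _ hu3 hw); ring.
rewrite (adu2_eigenN1 hv uw) (lie_leibniz x) (adx_eigen1 hu) lie0l add0r -/w uw.
rewrite !lieE (lieC u3 u) uu3 (lie_leibniz u3 p) u3w !lieE (lieC p x) xp.
rewrite (lieC u3 p) (ad_p_u3 uu3) !lieE uw.
by lincomb.
Qed.

(** The exponential of [ad u], whose fifth power is zero. *)
Definition exp_ad z : L :=
  z + [< u, z >] + 2^-1 *: [< u, [< u, z >] >]
    + (2^-1 * 3^-1) *: [< u, [< u, [< u, z >] >] >]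
    + (4^-1 * 2^-1 * 3^-1) *: [< u, [< u, [< u, [< u, z >] >] >] >].

Lemma exp_adD z1 z2 : exp_ad (z1 + z2) = exp_ad z1 + exp_ad z2.
Proof. by rewrite /exp_ad !lieDr; lincomb. Qed.

Lemma exp_adZ c z : exp_ad (c *: z) = c *: exp_ad z.
Proof. by rewrite /exp_ad !lieZr; lincomb. Qed.

Let e := exp_ad y.

Let eE c : [< u, u3 >] = c *: x ->
  e = y + q + 2^-1 *: p + (2^-1 * 3^-1) *: u3 + (4^-1 * 2^-1 * 3^-1 * c) *: x.
Proof. by rewrite /e /exp_ad -/q -/p -/u3 => ->; lincomb. Qed.

Lemma exp_ad_x : exp_ad x = x.
Proof. by rewrite /exp_ad ux !lie0r; lincomb. Qed.

Lemma exp_ad_eigen1 w o : [< u, w >] = o *: x -> exp_ad w = w + o *: x.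
Proof.
by move=> uw; rewrite /exp_ad uw !(lieZr, ux, scaler0, lie0r); lincomb.
Qed.

Lemma exp_ad_eigen0 d o : [< u, [< u, d >] >] = o *: x ->
  exp_ad d = d + [< u, d >] + (2^-1 * o) *: x.
Proof.
by move=> uw; rewrite /exp_ad uw !(lieZr, ux, scaler0, lie0r); lincomb.
Qed.

Lemma exp_ad_eigenN1 v o : [< u, [< u, [< u, v >] >] >] = o *: x ->
  exp_ad v = v + [< u, v >] + 2^-1 *: [< u, [< u, v >] >]
    + (2^-1 * 3^-1 * o) *: x.
Proof.
by move=> uw; rewrite /exp_ad uw !(lieZr, ux, scaler0, lie0r); lincomb.
Qed.

(** In this and the next lemmas, the powers of [ad u] are moved inside by the
    Leibniz rule, until both sides are combinations of brackets of [y], [q],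
    [p], [u3], [x] with the images of the argument under powers of [ad u]. *)
Lemma exp_ad_lie_eigen1 w : eigen h 1 w ->
  exp_ad [< y, w >] = [< e, exp_ad w >].
Proof.
move=> hw; have [c uu3] := uu3_line.
have [o uw] : exists o, [< u, w >] = o *: x.
  by apply: eigen2P; apply: (eigen_lie _ hu hw); ring.
have [o3 u3w] : exists o, [< u3, w >] = o *: x.
  by apply: eigen2P; apply: (eigen_lie _ hu3 hw); ring.
have uyw : [< u, [< y, w >] >] = [< q, w >] - o *: h.
  by rewrite lie_leibniz -/q uw lieZr yx scalerN.
have uqw : [< u, [< q, w >] >] = [< p, w >] + o *: u.
  by rewrite lie_leibniz -/p uw lieZr (lieC q) xq opprK.
have upw : [< u, [< p, w >] >] = o3 *: x.
  by rewrite lie_leibniz -/u3 uw lieZr (lieC p) xp u3w oppr0 scaler0 addr0.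
rewrite (exp_ad_eigen1 uw) (eE uu3) /exp_ad.
rewrite !(lieE, uyw, uqw, upw, uh, ux, lie_bracketxx).
rewrite (adx_eigen1 hw) u3w (lieC q x) (lieC p x) xq xp.
rewrite (lieC u3) (adx_eigen1 hu3) yx.
by lincomb.
Qed.

Lemma exp_ad_lie_x : exp_ad [< y, x >] = [< e, exp_ad x >].
Proof.
have [c uu3] := uu3_line.
rewrite exp_ad_x (eE uu3) /exp_ad yx.
rewrite !(lieE, uh, ux, lie_bracketxx).
rewrite (lieC q x) (lieC p x) xq xp (lieC u3) (adx_eigen1 hu3) yx.
by lincomb.
Qed.

Lemma exp_ad_lie_eigen0 d : eigen h 0 d ->
  exp_ad [< y, d >] = [< e, exp_ad d >].
Proof.
move=> hd; have [c uu3] := uu3_line.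
have hud : eigen h 1 [< u, d >] by apply: (eigen_lie _ hu hd); ring.
have [o uud] : exists o, [< u, [< u, d >] >] = o *: x.
  by apply: eigen2P; apply: (eigen_lie _ hu hud); ring.
have [o3 u3ud] : exists o, [< u3, [< u, d >] >] = o *: x.
  by apply: eigen2P; apply: (eigen_lie _ hu3 hud); ring.
have uyd : [< u, [< y, d >] >] = [< q, d >] + [< y, [< u, d >] >].
  exact: lie_leibniz.
have uqd : [< u, [< q, d >] >] = [< p, d >] + [< q, [< u, d >] >].
  exact: lie_leibniz.
have uyud : [< u, [< y, [< u, d >] >] >] = [< q, [< u, d >] >] - o *: h.
  by rewrite lie_leibniz -/q uud lieZr yx scalerN.
have upd : [< u, [< p, d >] >] = [< u3, d >] + [< p, [< u, d >] >].
  exact: lie_leibniz.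
have uqud : [< u, [< q, [< u, d >] >] >] = [< p, [< u, d >] >] + o *: u.
  by rewrite lie_leibniz -/p uud lieZr (lieC q) xq opprK.
have uu3d : [< u, [< u3, d >] >] = c *: [< x, d >] + o3 *: x.
  by rewrite lie_leibniz uu3 lieZl u3ud.
have upud : [< u, [< p, [< u, d >] >] >] = o3 *: x.
  by rewrite lie_leibniz -/u3 uud lieZr (lieC p) xp u3ud oppr0 scaler0 addr0.
rewrite (exp_ad_eigen0 uud) (eE uu3) /exp_ad.
rewrite !(lieE, uyd, uqd, uyud, upd, uqud, uu3d, upud, uh, lie_bracketxx).
rewrite u3ud (adx_eigen1 hud) (lieC q x) (lieC p x) xq xp.
rewrite (lieC u3 x) (adx_eigen1 hu3) yx.
by lincomb.
Qed.

Lemma exp_ad_lie_eigenN1 v : eigen h (- 1) v ->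
  exp_ad [< y, v >] = [< e, exp_ad v >].
Proof.
move=> hv; have [c uu3] := uu3_line.
pose v1 := [< u, v >]; pose v2 := [< u, v1 >].
have hv1 : eigen h 0 v1 by apply: (eigen_lie _ hu hv); ring.
have hv2 : eigen h 1 v2 by apply: (eigen_lie _ hu hv1); ring.
have [o uv2] : exists o, [< u, v2 >] = o *: x.
  by apply: eigen2P; apply: (eigen_lie _ hu hv2); ring.
(* [n1] to [n4] expand [(ad u)^n [y, v] = 0] by the Leibniz rule. *)
have n1 : [< q, v >] + [< y, v1 >] = 0.
  by rewrite -lie_leibniz (yN1 hv) lie0r.
have n2 : [< p, v >] + 2 *: [< q, v1 >] + [< y, v2 >] = 0.
  have := congr1 (fun z => [< u, z >]) n1.
  rewrite lieDr lie0r 2!(lie_leibniz u) -/p -/q -/v1 -/v2 => <-.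
  by lincomb.
have n3 : [< u3, v >] + 3 *: [< p, v1 >] + 3 *: [< q, v2 >] - o *: h = 0.
  have := congr1 (fun z => [< u, z >]) n2.
  rewrite !lieE 3!(lie_leibniz u) -/u3 -/p -/q -/v1 -/v2 uv2 lieZr yx => <-.
  by lincomb.
have n4 : c *: [< x, v >] + 4 *: [< u3, v1 >] + 6 *: [< p, v2 >]
    + (4 * o) *: u = 0.
  have := congr1 (fun z => [< u, z >]) n3.
  rewrite !lieE 3!(lie_leibniz u) -/u3 -/p -/q -/v1 -/v2 uv2 uu3 uh !lieE.
  by rewrite (lieC q x) xq => <-; lincomb.
have n5 : c *: [< x, v1 >] + 2 *: [< u3, v2 >] = 0 by apply: exp_cocycle.
rewrite (exp_ad_eigenN1 uv2) (eE uu3) (yN1 hv) -/v1 -/v2.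
rewrite /exp_ad !lieE (adx_eigen1 hv2) (lieC q x) (lieC p x) xq xp.
rewrite (lieC u3 x) (adx_eigen1 hu3).
rewrite yx lie_bracketxx ?(yN1 hv).
have -> : [< y, v1 >] = - [< q, v >].
  by apply/eqP; rewrite -addr_eq0 addrC n1.
have -> : [< y, v2 >] = - ([< p, v >] + 2 *: [< q, v1 >]).
  by apply/eqP; rewrite -addr_eq0 addrC n2.
have -> : [< u3, v >] = - (3 *: [< p, v1 >] + 3 *: [< q, v2 >] - o *: h).
  by apply/eqP; rewrite -addr_eq0 !addrA n3.
have -> : [< u3, v1 >]
    = - (4^-1 *: (c *: [< x, v >] + 6 *: [< p, v2 >] + (4 * o) *: u)).
  apply: (scalerI nz4); apply/eqP; rewrite -subr_eq0; apply/eqP.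
  by rewrite -[RHS]n4; lincomb.
have -> : [< u3, v2 >] = - ((2^-1 * c) *: [< x, v1 >]).
  apply: (scalerI nz2); apply/eqP; rewrite -subr_eq0; apply/eqP.
  by rewrite -[RHS]n5; lincomb.
by lincomb.
Qed.

(** By linearity, the rule is checked on weight vectors; only weight -1
    requires [exp_cocycle]. *)
Lemma exp_ad_lie z : exp_ad [< y, z >] = [< e, exp_ad z >].
Proof.
have [a [v [d [w [b [-> hv hd hw xw]]]]]] := sl2_decomp z extx hx hy.
have lD z1 z2 : exp_ad [< y, z1 >] = [< e, exp_ad z1 >] ->
    exp_ad [< y, z2 >] = [< e, exp_ad z2 >] ->
    exp_ad [< y, z1 + z2 >] = [< e, exp_ad (z1 + z2) >].
  by move=> l1 l2; rewrite lieDr !exp_adD l1 l2 -lieDr.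
have lZ k z1 : exp_ad [< y, z1 >] = [< e, exp_ad z1 >] ->
    exp_ad [< y, k *: z1 >] = [< e, exp_ad (k *: z1) >].
  by move=> l1; rewrite lieZr !exp_adZ l1 -lieZr.
have ly : exp_ad [< y, y >] = [< e, exp_ad y >].
  by rewrite !lie_bracketxx /exp_ad !lie0r; lincomb.
apply: (lD); last by apply: lZ; apply: exp_ad_lie_x.
apply: (lD); last exact: exp_ad_lie_eigen1.
apply: (lD); last exact: exp_ad_lie_eigen0.
by apply: lD; [apply: lZ | apply: exp_ad_lie_eigenN1].
Qed.

(** [exp_ad] is unitriangular for the filtration by weight. *)
Lemma exp_ad_surj z : exists t, exp_ad t = z.
Proof.
have imD z1 z2 : (exists t, exp_ad t = z1) -> (exists t, exp_ad t = z2) ->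
    exists t, exp_ad t = z1 + z2.
  by move=> [t1 <-] [t2 <-]; exists (t1 + t2); rewrite exp_adD.
have imZ c z1 : (exists t, exp_ad t = z1) -> exists t, exp_ad t = c *: z1.
  by move=> [t1 <-]; exists (c *: t1); rewrite exp_adZ.
have imx : exists t, exp_ad t = x by exists x; apply: exp_ad_x.
have im1 w : eigen h 1 w -> exists t, exp_ad t = w.
  move=> hw; have [o uw] : exists o, [< u, w >] = o *: x.
    by apply: eigen2P; apply: (eigen_lie _ hu hw); ring.
  have -> : w = exp_ad w + (- o) *: x.
    by rewrite (exp_ad_eigen1 uw); lincomb.
  by apply: imD; [exists w | apply: imZ].
have im0 d : eigen h 0 d -> exists t, exp_ad t = d.
  move=> hd; have hud : eigen h 1 [< u, d >].
    by apply: (eigen_lie _ hu hd); ring.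
  have [o uud] : exists o, [< u, [< u, d >] >] = o *: x.
    by apply: eigen2P; apply: (eigen_lie _ hu hud); ring.
  have -> : d = exp_ad d + (-1) *: [< u, d >] + (- (2^-1 * o)) *: x.
    by rewrite (exp_ad_eigen0 uud); lincomb.
  apply: (imD); last exact: imZ.
  by apply: imD; [exists d | apply: imZ; apply: im1].
have imN1 v : eigen h (- 1) v -> exists t, exp_ad t = v.
  move=> hv; have huv : eigen h 0 [< u, v >].
    by apply: (eigen_lie _ hu hv); ring.
  have huuv : eigen h 1 [< u, [< u, v >] >].
    by apply: (eigen_lie _ hu huv); ring.
  have [o uuuv] : exists o, [< u, [< u, [< u, v >] >] >] = o *: x.
    by apply: eigen2P; apply: (eigen_lie _ hu huuv); ring.
  have -> : v = exp_ad v + (-1) *: [< u, v >]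
     + (- 2^-1) *: [< u, [< u, v >] >] + (- (2^-1 * 3^-1 * o)) *: x.
    by rewrite (exp_ad_eigenN1 uuuv); lincomb.
  apply: (imD); last exact: imZ.
  apply: (imD); last by apply: imZ; apply: im1.
  by apply: imD; [exists v | apply: imZ; apply: im0].
have imy : exists t, exp_ad t = y.
  have [c uu3] := uu3_line.
  have -> : y = e + (- 1) *: q + (- 2^-1) *: p + (- (2^-1 * 3^-1)) *: u3
      + (- (4^-1 * 2^-1 * 3^-1 * c)) *: x by rewrite (eE uu3); lincomb.
  apply: (imD); last exact: imZ.
  apply: (imD); last by apply: imZ; apply: im1.
  apply: (imD); last by apply: imZ; apply: im0.
  by apply: imD; [exists y | apply: imZ; apply: imN1].
have [a [v [d [w [b [-> hv hd hw xw]]]]]] := sl2_decomp z extx hx hy.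
apply: (imD); last exact: imZ.
apply: (imD); last exact: im1.
apply: (imD); last exact: im0.
by apply: imD; [apply: imZ | apply: imN1].
Qed.

(** Extremality of [y] is transported by [exp_ad], which is onto. *)
Lemma extremal_exp_ad : extremal e.
Proof.
move=> z; have [t <-] := exp_ad_surj z.
have [c cE] := extremal_opposite t.
by exists c; rewrite -!exp_ad_lie cE exp_adZ.
Qed.

(** The component of weight -1 of [e] is isolated by means of [ad h], then
    moved to weight 1 by [ad x]. *)
Lemma eigen1_in_extremal_span : lie_span (@extremal F L) u.
Proof.
have [spanS Sl] := lie_span_subalgebra (@extremal F L).
have Sx : lie_span (@extremal F L) x by apply: lie_span_gen.
have Sy : lie_span (@extremal F L) y.
  by apply: lie_span_gen; apply: extremal_opposite.
have Se : lie_span (@extremal F L) e.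
  by apply: lie_span_gen; apply: extremal_exp_ad.
have [c uu3] := uu3_line.
have SZ := subspaceZ _ spanS; have SD := subspaceD spanS.
pose r := e + (-1) *: y + (- (4^-1 * 2^-1 * 3^-1 * c)) *: x.
have rE : r = q + 2^-1 *: p + (2^-1 * 3^-1) *: u3.
  by rewrite /r (eE uu3); lincomb.
have Sr : lie_span (@extremal F L) r.
  by apply: (SD); [apply: SD => //; apply: (SZ) | apply: SZ].
have Sh := Sl _ _ Sx Sy.
(* [ad h] has eigenvalues -1, 0, 1 on [r], and [(H^2 - H) / 2] is the projection
   onto weight -1. *)
have -> : u = (- 1) *: [< x, 2^-1 *: [< h, [< h, r >] >]
    + (- 2^-1) *: [< h, r >] >].
  rewrite rE !(lieE, hq, hp, hu3) xq (adx_eigen1 hu3).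
  by lincomb.
by apply: (SZ); apply: (Sl) => //; apply: SD; apply: SZ; do !apply: (Sl).
Qed.

End Exponential.

Lemma extremal_generation : lie_simple L -> x <> 0 ->
  lie_generated_by (@extremal F L).
Proof.
move=> simL xnz.
have subS := lie_span_subalgebra (@extremal F L); have [_ Sl] := subS.
have Sy : lie_span (@extremal F L) y.
  by apply: lie_span_gen; apply: extremal_opposite.
apply: (generated_by_odd_part simL xnz subS) => //.
- exact: lie_span_gen.
- exact: eigen1_in_extremal_span.
move=> v hv; rewrite -(ady_adx_eigenN1 hv); last by rewrite yN1 // lie0r.
by apply: Sl => //; apply: eigen1_in_extremal_span; apply: adx_eigenN1.
Qed.

End ExtremalGeneration.

(** * The Witt algebra in characteristic 5 *)

Section WittCase.
Hypotheses (char5 : 5%N \in [pchar F]) (simL : lie_simple L) (xnz : x <> 0).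

Let five0 : 5 = 0 :> F.
Proof. exact: pcharf0. Qed.

Let eq_mod5 a b k : a = b + k * 5 -> a = b.
Proof. by rewrite five0 mulr0 addr0. Qed.

(* In the identities at hand, both sides differ by a small multiple of 5. *)
Ltac by_mod5 := first [ring
  | by apply: (@eq_mod5 _ _ 1); ring | by apply: (@eq_mod5 _ _ (- 1)); ring
  | by apply: (@eq_mod5 _ _ 2); ring | by apply: (@eq_mod5 _ _ (- 2)); ring
  | by apply: (@eq_mod5 _ _ 3); ring | by apply: (@eq_mod5 _ _ (- 3)); ring
  | by apply: (@eq_mod5 _ _ 4); ring | by apply: (@eq_mod5 _ _ (- 4)); ring].
Ltac lincomb5 := lincomb_with F L ltac:(by_mod5).

Variable v : L.
Hypotheses (hv : eigen h (- 1) v) (yv : [< y, v >] = x).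

Let w := [< x, v >].

Let hw : eigen h 1 w.
Proof. exact: adx_eigenN1. Qed.

Let xw : [< x, w >] = 0.
Proof. exact: adx_eigen1. Qed.

Let yN1_line v' : eigen h (- 1) v' -> exists c, [< y, v' >] = c *: x.
Proof.
by move=> hv'; apply: eigen2P; apply: (eigen_lie _ hy hv'); by_mod5.
Qed.

Let yx_inv v' : eigen h (- 1) v' -> [< y, [< x, v' >] >] = v'.
Proof.
move=> hv'; apply: (ady_adx_eigenN1 hv'); have [c ->] := yN1_line hv'.
by rewrite lieZr lie_bracketxx scaler0.
Qed.

Let yw : [< y, w >] = v.
Proof. exact: yx_inv. Qed.

(** Apply [ad y] to [[v, v']], which is a multiple of [y]: the result
    [[x, v' - c v]] is zero, and [ad x] is injective on weight -1. *)
Lemma eigenN1_line v' : eigen h (- 1) v' -> exists c, v' = c *: v.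
Proof.
move=> hv'; have [c yv'] := yN1_line hv'; exists c.
have ht : eigen h (- 1) (v' - c *: v).
  by rewrite /eigen !lieE hv hv'; lincomb5.
apply/eqP; rewrite -subr_eq0 -(yx_inv ht); apply/eqP.
have [m vv'] : exists m, [< v, v' >] = m *: y.
  by apply: eigenN2P; apply: (eigen_lie _ hv hv'); ring.
suff -> : [< x, v' - c *: v >] = 0 by rewrite lie0r.
have : [< y, [< v, v' >] >] = 0 by rewrite vv' lieZr lie_bracketxx scaler0.
by rewrite lie_leibniz yv yv' lieZr (lieC v) !lieE scalerN.
Qed.

Lemma eigen1_line w' : eigen h 1 w' -> exists c, w' = c *: w.
Proof.
move=> hw'; have [c yw'] := eigenN1_line (ady_eigen1 hw').
exists c; rewrite -(adx_ady_eigen1 hw') yw'.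
exact: lieZr.
Qed.

Lemma generated_by_sl2_odd M : lie_subalgebra M -> M x -> M y -> M v ->
  forall z, M z.
Proof.
move=> subM Mx My Mv; have [spanM Ml] := subM.
apply: (generated_by_odd_part simL xnz subM) => // z.
  move=> /eigen1_line[c ->]; apply: (subspaceZ _ spanM).
  exact: Ml.
by move=> /eigenN1_line[c ->]; apply: (subspaceZ _ spanM).
Qed.

(** The element [[v, w]] commutes with [x], [y] and [v], which generate [L]. *)
Lemma lie_vw : [< v, w >] = 0.
Proof.
have hvw : eigen h 0 [< v, w >] by apply: (eigen_lie _ hv hw); ring.
have yvw : [< y, [< v, w >] >] = 0.
  by rewrite lie_leibniz yv yw xw lie_bracketxx addr0.
have xvw : [< x, [< v, w >] >] = 0.
  by rewrite lie_leibniz -/w xw lie_bracketxx lie0r addr0.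
have [c vwv] : exists c, [< v, [< v, w >] >] = c *: v.
  by apply: eigenN1_line; apply: (eigen_lie _ hv hvw); ring.
have cx : c *: x = 0.
  by rewrite -yv -lieZr -vwv lie_leibniz yv yvw xvw lie0r addr0.
have {}vwv : [< v, [< v, w >] >] = 0.
  rewrite vwv; case/eqP: cx; rewrite scaler_eq0 => /orP[/eqP->|/eqP//].
  exact: scale0r.
apply: (simple_center_eq0 simL); apply: generated_by_sl2_odd.
- exact: centralizer_subalgebra.
- by rewrite lieC xvw oppr0.
- by rewrite lieC yvw oppr0.
by rewrite lieC vwv oppr0.
Qed.

(** The images of the [z^i d/dz]. The first, [d/dz], goes to [y], and
    [z d/dz] to [h / 2 = 3 h]; the others follow by weight from
    [[d/dz, z^i d/dz] = i z^(i-1) d/dz]. *)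
Definition witt_vector (i : nat) : L :=
  nth 0 [:: y; 3 *: h; - x; 2 *: v; 3 *: w] i.

Let of_witt (r : witt5 char5) : L :=
  \sum_(i < 5) (r : 'rV[F]_5) 0 i *: witt_vector i.

Let of_witt_linear : linear of_witt.
Proof.
move=> a r s; rewrite /of_witt scaler_sumr -big_split; apply: eq_bigr => i _ /=.
by rewrite !mxE scalerDl scalerA.
Qed.

HB.instance Definition _ :=
  GRing.isLinear.Build F (witt5 char5) L _ of_witt of_witt_linear.

Let of_witt_basis (k : int) (i : nat) : k = i%:Z ->
  of_witt (witt_basis F k) = witt_vector i.
Proof.
move=> ->; have [lti|lei] := ltnP i 5; last first.
  rewrite /witt_vector nth_default // /of_witt big1 // => j _.
  by rewrite mxE eqz_nat ltn_eqF ?scale0r // (leq_trans (ltn_ord j)).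
rewrite /of_witt (bigD1 (Ordinal lti)) //= mxE eqxx scale1r.
rewrite big1 ?addr0 // => j nj.
by rewrite mxE eqz_nat (negPf nj : (j == i :> nat) = false) scale0r.
Qed.

Let of_witt_basisN1 : of_witt (witt_basis F (- 1)) = 0.
Proof. by rewrite /of_witt big1 // => j _; rewrite mxE scale0r. Qed.

Let xh : [< x, h >] = - 2 *: x.
Proof. by rewrite lieC hx scaleNr. Qed.

Let yh : [< y, h >] = 2 *: y.
Proof. by rewrite lieC hy scaleNr opprK. Qed.

Let vh : [< v, h >] = v.
Proof. by rewrite lieC hv scaleN1r opprK. Qed.

Let wh : [< w, h >] = - w.
Proof. by rewrite lieC hw scale1r. Qed.

Let lie_table := (hx, hy, hv, hw, xh, yh, vh, wh, lieC y x, xw, yv, yw,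
  lie_vw, lieC v x, lieC v y, lieC w x, lieC w y, lieC w v, @lie_bracketxx F L).

Lemma lie_witt_vector (i j : 'I_5) :
  [< witt_vector i, witt_vector j >]
    = (j%:R - i%:R) *: of_witt (witt_basis F (i%:Z + j%:Z - 1)).
Proof.
case: i => [[|[|[|[|[|i]]]]] lti] //=; case: j => [[|[|[|[|[|j]]]]] ltj] //=;
 ((rewrite (@of_witt_basis _ 0); [|by []])
  || (rewrite (@of_witt_basis _ 1); [|by []])
  || (rewrite (@of_witt_basis _ 2); [|by []])
  || (rewrite (@of_witt_basis _ 3); [|by []])
  || (rewrite (@of_witt_basis _ 4); [|by []])
  || (rewrite (@of_witt_basis _ 5); [|by []])
  || (rewrite (@of_witt_basis _ 6); [|by []])
  || (rewrite (@of_witt_basis _ 7); [|by []])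
  || rewrite of_witt_basisN1);
 rewrite /witt_vector /= ?lieE ?lie_table ?lieE -?/w ?lie_table ?lieE; lincomb5.
Qed.

Let of_witt_lie (r s : witt5 char5) :
  of_witt [< r, s >] = [< of_witt r, of_witt s >].
Proof.
transitivity (\sum_(i < 5) \sum_(j < 5)
    (r : 'rV[F]_5) 0 i *: ((s : 'rV[F]_5) 0 j *:
      [< witt_vector i, witt_vector j >])).
  rewrite [LHS](linear_sum of_witt); apply: eq_bigr => i _.
  rewrite linear_sum; apply: eq_bigr => j _.
  by rewrite linearZ /= lie_witt_vector !scalerA.
rewrite [RHS]lieC /of_witt lie_sum -sumrN; apply: eq_bigr => i _.
rewrite lieZr -scalerN -lieC lie_sum scaler_sumr; apply: eq_bigr => j _.
by rewrite lieZr.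
Qed.

Lemma isomorphic_witt5 : lie_isomorphic L (witt5 char5).
Proof.
have ynz : y <> 0 by move=> y0; apply: xnz; rewrite -yv y0 lie0l.
have vnz : v <> 0 by move=> v0; apply: xnz; rewrite -yv v0 lie0r.
have wnz : w <> 0 by move=> w0; apply: vnz; rewrite -yw w0 lie0r.
have hnz : h <> 0.
  move=> h0; apply: xnz; apply: (scalerI nz2).
  by rewrite -hx h0 lie0l scaler0.
have bnz i : (i < 5)%N -> witt_vector i <> 0.
  case: i => [|[|[|[|[|i]]]]] //= _; rewrite /witt_vector /=.
  - by move=> /eqP; rewrite scaler_eq0 (negPf nz3) => /eqP.
  - by move=> /eqP; rewrite oppr_eq0 => /eqP.
  - by move=> /eqP; rewrite scaler_eq0 (negPf nz2) => /eqP.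
  by move=> /eqP; rewrite scaler_eq0 (negPf nz3) => /eqP.
(* The weight of [z^i d/dz] is [2 (i - 1)], and 2 generates the additive group
   of integers modulo 5. *)
pose lam (i : 'I_5) : F := i%:R * 2 - 2.
have lam_inj : injective lam.
  move=> i j /addIr/(mulIf nz2) eq_ij; apply/val_inj/eqP.
  wlog leij : i j eq_ij / (i <= j)%N => [IH|].
    by have [/IH->//|/ltnW/IH] := leqP i j; rewrite eq_sym => ->.
  have dvd5 : (5 %| j - i)%N.
    by rewrite (dvdn_pcharf char5) natrB // eq_ij subrr.
  rewrite eqn_leq leij -subn_eq0 /=; case: posnP => // ij_gt0.
  have lt5 : (j - i < 5)%N := leq_ltn_trans (leq_subr i j) (ltn_ord j).
  by rewrite gtnNdvd in dvd5.
have hb (i : 'I_5) : eigen h (lam i) (witt_vector i).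
  case: i => [[|[|[|[|[|i]]]]] lti] //=;
    rewrite /lam /eigen /witt_vector /= ?lieE ?lie_table ?lieE;
    rewrite -?/w ?lie_table ?lieE; lincomb5.
apply: (@lie_isomorphic_from_inverse F L (witt5 char5) of_witt).
- apply: raddf_inj => r gr0; apply/rowP => i; rewrite mxE.
  have := eigen_sum_eq0 (h := h) (lam := lam) (s := index_enum 'I_5)
    (f := fun i => (r : 'rV[F]_5) 0 i *: witt_vector i).
  rewrite map_inj_uniq ?index_enum_uniq // => /(_ isT) ri.
  have /eqP : (r : 'rV[F]_5) 0 i *: witt_vector i = 0.
    apply: ri => //; last exact: mem_index_enum.
    by move=> j; apply: eigenZ.
  by rewrite scaler_eq0 => /orP[/eqP|/eqP/bnz] // /(_ (ltn_ord i)).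
- apply: generated_by_sl2_odd.
  + split; [split|].
    * by exists 0; rewrite linear0.
    * by move=> a _ _ [r <-] [s <-]; exists (a *: r + s); rewrite linearP.
    by move=> _ _ [r <-] [s <-]; exists [< r, s >]; apply: of_witt_lie.
  + exists (- 1 *: (witt_basis F 2 : witt5 char5)).
    by rewrite linearZ /= (@of_witt_basis _ 2) // /witt_vector /=; lincomb5.
  + by exists (witt_basis F 0); apply: (@of_witt_basis _ 0).
  exists (3 *: (witt_basis F 3 : witt5 char5)).
  by rewrite linearZ /= (@of_witt_basis _ 3) // /witt_vector /=; lincomb5.
exact: of_witt_lie.
Qed.

End WittCase.

End Graded.

End Triple.

(** * The theorem *)

Theorem theorem1p1 (F : fieldType) (charF2 : 2 \notin [pchar F]%R)
    (charF3 : 3 \notin [pchar F]%R) (L : lieAlgType F) (simpleL : lie_simple L)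
    (extL : exists x : L, extremal x /\ ~ sandwich x) :
  (exists charF5 : 5 \in [pchar F]%R, lie_isomorphic L (witt5 charF5)) \/
  lie_generated_by (@extremal F L).
Proof.
have nz2 : (2 != 0 :> F)%R.
  by apply: contraNN charF2 => /eqP e2; rewrite !inE e2 eqxx.
have nz3 : (3 != 0 :> F)%R.
  by apply: contraNN charF3 => /eqP e3; rewrite !inE e3 eqxx.
have [x [extx nsand]] := extL.
have xnz : x <> 0%R.
  by move=> x0; apply: nsand => y; rewrite x0 !lie0l.
have [y [hx hy]] := extremal_sl2 nz2 nz3 extx nsand.
set h := [< x, y >]%R in hx hy.
have [yN1|] := classic (forall v, eigen h (- 1)%R v -> [< y, v >]%R = 0%R).
  by right; apply: (extremal_generation nz2 nz3 extx hx hy).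
move=> nyN1; have [v nyv] := not_all_ex_not _ _ nyN1.
have [hv /eqP yv] := imply_to_and _ _ nyv; left.
have hyv : eigen h (- 3)%R [< y, v >]%R.
  by apply: (eigen_lie _ hy hv); ring.
have five0 : (5 == 0 :> F)%R.
  apply: contraNT yv => nz5; apply/eqP.
  exact: (eigenN3_eq0 nz2 nz3 extx hx hy nz5).
have char5 : 5 \in [pchar F]%R by rewrite !inE five0.
have [c yvE] : exists c, [< y, v >]%R = (c *: x)%R.
  apply: (eigen2P nz2 nz3 extx hx hy); move: hyv.
  rewrite (_ : - 3 = 2 :> F)%R //; apply/eqP.
  rewrite -GRing.subr_eq0 -GRing.oppr_eq0.
  by rewrite (_ : - (- 3 - 2) = 5 :> F)%R //; ring.
have nzc : (c != 0)%R.
  by apply: contraNneq yv => c0; rewrite yvE c0 GRing.scale0r.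
exists char5; apply: (isomorphic_witt5 nz2 nz3 extx hx hy char5 simpleL xnz
  (v := (c^-1 *: v)%R)); first exact: eigenZ.
by rewrite lieZr yvE GRing.scalerA GRing.mulVf // GRing.scale1r.
Qed.
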